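(* Let $n\ge m\ge 1$ be integers, let $0<\lambda_1<\lambda_2<\cdots<\lambda_m$ be real numbers and let $t_1,\dots,t_m$ be positive integers with $\sum_{i=1}^m t_i=n$. Then there exist real numbers $m_j>0$, $k_j>0$, $b_j\ge 0$ ($j=1,\dots,n$) such that the associated $n\times n$ matrices $\boldsymbol{M},\boldsymbol{K},\boldsymbol{B}$ (defined in the context) satisfy $$\prod_{i=1}^{m}(\lambda-\lambda_i)^{t_i}\ \Big|\ \det\big(\boldsymbol{K}-\lambda(\boldsymbol{M}+\boldsymbol{B})\big)$$ (divisibility of real polynomials in $\lambda$) if and only if $$t_i\le i,\qquad i=1,\dots,m.$$
   Context: For real numbers $m_j>0$ (masses), $k_j>0$ (spring stiffnesses), $b_j\ge 0$ (inertances), $j=1,\dots,n$, define $n\times n$ real matrices as follows. $\boldsymbol{M}=\mathrm{diag}\{m_1,\dots,m_n\}$. $\boldsymbol{K}$ is the symmetric tridiagonal matrix with diagonal entries $\boldsymbol{K}_{jj}=k_j+k_{j+1}$ for $1\le j\le n-1$, $\boldsymbol{K}_{nn}=k_n$, and off-diagonal entries $\boldsymbol{K}_{j,j+1}=\boldsymbol{K}_{j+1,j}=-k_{j+1}$ for $1\le j\le n-1$ (all other entries zero). $\boldsymbol{B}$ is the symmetric tridiagonal matrix defined in the same way with $b_j$ in place of $k_j$: $\boldsymbol{B}_{jj}=b_j+b_{j+1}$ for $1\le j\le n-1$, $\boldsymbol{B}_{nn}=b_n$, $\boldsymbol{B}_{j,j+1}=\boldsymbol{B}_{j+1,j}=-b_{j+1}$.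 *)

(* Defs.v *)
From HB Require Import structures.
From mathcomp Require Import all_boot all_order all_algebra.
Set Implicit Arguments.
Unset Strict Implicit.
Unset Printing Implicit Defensive.

Import GRing.Theory.
Local Open Scope ring_scope.

(* The indices 1, ..., n of the masses, springs and inerters are shifted to
   0, ..., n-1, so that [c i] stands for c_(i+1). *)

(* The coefficient following [c i], or 0 when [i] is the last index; this is
   what makes the bottom-right entry of [chain_mx c] equal to c_n alone. *)
Definition next_coef (R : nzRingType) (n : nat) (c : 'I_n -> R) (i : 'I_n) : R :=
  oapp c 0 (insub i.+1).

Definition chain_mx (R : nzRingType) (n : nat) (c : 'I_n -> R) : 'M[R]_n :=
  \matrix_(i, j)
    if i == j then c i + next_coef c i
    else if (j == i.+1 :> nat) then - c j
    else if (i == j.+1 :> nat) then - c i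
    else 0.

Definition mass_mx (R : nzRingType) (n : nat) (c : 'I_n -> R) : 'M[R]_n :=
  diag_mx (\row_j c j).

Definition pencil_det (R : comNzRingType) (n : nat) (K A : 'M[R]_n) : {poly R} :=
  \det (map_mx polyC K - 'X *: map_mx polyC A).

(* Main.v *)
Require Import Defs.
From HB Require Import structures.
From mathcomp Require Import all_boot all_order all_algebra reals.
From mathcomp Require Import ring boolp classical_sets topology normedtype sequences.
Set Implicit Arguments.
Unset Strict Implicit.
Unset Printing Implicit Defensive.

Import Order.TTheory GRing.Theory Num.Theory numFieldNormedType.Exports.
Local Open Scope ring_scope.

(* Write z_j = k_j - X b_j.

   Necessity. The multiplicity of lam_i is at most the nullity of
   K - lam_i (M + B), and a tridiagonal matrix of nullity t has at least t - 1
   vanishing off-diagonal entries; so at least t_l - 1 links satisfy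
   k_j = lam_l b_j. The form of K - lam_i (M + B) is negative on the vectors that
   stretch only the links with k_j <= lam_i b_j. These vectors form a space whose
   dimension is the number of such links, hence at least the sum of t_l - 1 over
   l <= i, and at most the number of eigenvalues below lam_i, which is the sum of
   t_l over l < i. Comparing gives t_i <= i.

   Sufficiency. A chain is encoded by the pair (D, E) of its characteristic
   polynomials with free and with clamped end mass, and taken apart from the free
   end. Removing a mass w replaces D by D + w X E. A spring then splits off when
   the degree of D has dropped; a link with z_j proportional to nu - X splits off
   when D + w X E vanishes at nu, which changes (D, E) as little as desired and
   contributes a factor nu - X common to the two polynomials of the chain.
   Take D = (lam_1 - X) ... (lam_m - X) and E close to (lam_2 - X) ... (lam_m - X),
   so that E / D is close to 1 / (lam_1 - X). Splitting off a spring leaves a pair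
   close to (D / (lam_1 - X), E'), up to scaling, with prescribed E'. Removing
   further small masses then makes D vanish successively at lam_m, ..., lam_2, and
   a link of the second kind is inserted at each lam_i with t_i >= 2. What remains
   is close to a pair for (lam_2, t_2 - 1), ..., (lam_m, t_m - 1), with t_i - 1
   replaced by 1 where t_i = 1; such a pair exists by induction, and the
   requirements on it (masses and stiffnesses come out positive) are open. *)

(** * Necessity *)

(** For a row [x] of displacements, [x *m diff_mx R n] lists the elongations [x_j - x_(j-1)] of the
    links, the ground before index 0 being at rest. *)
Definition diff_mx (R : nzRingType) (n : nat) : 'M[R]_n :=
  \matrix_(i, j) ((i == j)%:R - (j == i.+1 :> nat)%:R).

(** Turns the form of [chain_mx c] into the sum of [c j] times squared elongations, as for the
    energy stored in the links. *)
Lemma chain_mx_diff (R : comNzRingType) (n : nat) (c : 'I_n -> R) :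
  chain_mx c = diff_mx R n *m diag_mx (\row_j c j) *m (diff_mx R n)^T.
Proof.
apply/matrixP=> i j; rewrite mul_mx_diag !mxE.
under eq_bigr => l _ do
  rewrite !mxE (mulrC (_ - _)) -mulrA mulrBl !mulrBr.
rewrite big_split /= sumrN.
have sum1 (F : 'I_n -> R) (a : 'I_n) :
    \sum_l c l * ((a == l)%:R * F l) = c a * F a.
  rewrite (bigD1 a) //= eqxx mul1r big1 ?addr0 // => l.
  by rewrite eq_sym => /negbTE ->; rewrite mul0r mulr0.
have -> : \sum_l (c l * ((i == l)%:R * (j == l)%:R)
    - c l * ((i == l)%:R * (l == j.+1 :> nat)%:R)) =
    c i * (j == i)%:R - c i * (i == j.+1 :> nat)%:R.
  by rewrite big_split /= sumrN !sum1.
have -> : \sum_l (c l * ((l == i.+1 :> nat)%:R * (j == l)%:R)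
    - c l * ((l == i.+1 :> nat)%:R * (l == j.+1 :> nat)%:R)) =
    c j * (j == i.+1 :> nat)%:R - (i == j)%:R * next_coef c i.
  rewrite big_split /= sumrN; congr (_ - _).
    by under eq_bigr => l _ do rewrite (mulrC (_%:R)); rewrite sum1.
  rewrite /next_coef; case: insubP => /= [l _ el|].
    rewrite (bigD1 l) //= big1 => [|l' /negbTE nl'].
      rewrite -el eqxx mul1r addr0 mulrC; congr (_%:R * _).
      by rewrite el eqSS.
    by rewrite -el -val_eqE /= in nl' *; rewrite nl' mul0r mulr0.
  (* At the last index no [l] equals [i.+1], in agreement with the default 0 of [next_coef]. *)
  rewrite -leqNgt mulr0 => nle; rewrite big1 // => l _.
  have /ltn_eqF -> : (l < i.+1)%N by apply: leq_trans nle.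
  by rewrite mul0r mulr0.
rewrite -[j == i]val_eqE -[i == j]val_eqE /= [(j == i :> nat)]eq_sym.
case: (ltngtP i j) => [ij|ji|/val_inj ->] /=.
- rewrite (ltn_eqF (leqW ij)) /= !mulr0 mul0r !subr0 sub0r.
  by case: eqVneq; rewrite /= ?mulr1 ?mulr0 ?oppr0.
- rewrite (ltn_eqF (leqW ji)) /= !mulr0 mul0r !subr0 sub0r.
  by case: eqVneq; rewrite /= ?mulr1 ?mulr0 ?oppr0.
by rewrite !(ltn_eqF (leqnn _)) /= !mulr0 !subr0 mulr1 mul1r sub0r opprK.
Qed.

Lemma chain_mx_sym (R : nzRingType) (n : nat) (c : 'I_n -> R) :
  (chain_mx c)^T = chain_mx c.
Proof.
apply/matrixP=> i j; rewrite !mxE eq_sym; case: eqVneq => [->//|_].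
case: (eqVneq (i : nat) j.+1) => [ij|//].
by rewrite ij ltn_eqF // leqW.
Qed.

Lemma mass_mx_sym (R : nzRingType) (n : nat) (c : 'I_n -> R) :
  (mass_mx c)^T = mass_mx c.
Proof. by rewrite tr_diag_mx. Qed.

Definition qform (R : nzRingType) (n : nat) (A : 'M[R]_n) (x : 'rV[R]_n) : R :=
  (x *m A *m x^T) 0 0.

Section Qform.
Variables (R : comNzRingType) (n : nat).
Implicit Types (A B : 'M[R]_n) (x : 'rV[R]_n).

Lemma qformD A B x : qform (A + B) x = qform A x + qform B x.
Proof. by rewrite /qform mulmxDr mulmxDl mxE. Qed.

Lemma qformB A B x : qform (A - B) x = qform A x - qform B x.
Proof. by rewrite /qform mulmxBr mulmxBl !mxE. Qed.

Lemma qformZ a A x : qform (a *: A) x = a * qform A x.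
Proof. by rewrite /qform -scalemxAr -scalemxAl mxE. Qed.

Lemma qform_mass (c : 'I_n -> R) x :
  qform (mass_mx c) x = \sum_j c j * x 0 j ^+ 2.
Proof.
rewrite /qform mul_mx_diag !mxE; apply: eq_bigr => j _.
by rewrite !mxE mulrAC mulrC -expr2.
Qed.

Lemma qform_chain (c : 'I_n -> R) x :
  qform (chain_mx c) x = \sum_j c j * (x *m diff_mx R n) 0 j ^+ 2.
Proof.
rewrite chain_mx_diff /qform !mulmxA -mulmxA -trmx_mul.
exact: qform_mass.
Qed.
End Qform.

(** The columns of [N] indexed by [S] map [V] injectively into a space of dimension [#|S|]. *)
Lemma rank_le_card (F : fieldType) (p n q : nat) (V : 'M[F]_(p, n))
    (N : 'M[F]_(n, q)) (S : {set 'I_q}) :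
  (forall x : 'rV_n, (x <= V)%MS ->
     (forall j, j \in S -> (x *m N) 0 j = 0) -> x = 0) ->
  (\rank V <= #|S|)%N.
Proof.
move=> inj; pose N' := colsub (enum_val : 'I_#|S| -> 'I_q) N.
rewrite -(mxrank_mul_ker V N') [X in (_ + X)%N](_ : _ = 0%N).
  by rewrite addn0 rank_leq_col.
apply/eqP; rewrite mxrank_eq0; apply/eqP/row_matrixP => i; rewrite row0.
have := row_sub i (V :&: kermx N')%MS; rewrite sub_capmx => /andP[xV /sub_kermxP xN].
apply: inj => // j jS; move/rowP/(_ (enum_rank_in jS j)): xN.
rewrite !mxE => {2}<-; apply: eq_bigr => l _.
by rewrite /N' [colsub _ _ _ _]mxE enum_rankK_in.
Qed.

(** * Multiplicities, nullities and signature of the pencil *)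

Section Pencil.
Variables (F : realFieldType) (n : nat).

(* With [Y A0] having only [r = \rank A0] nonzero rows, each of the other
   rows of [Y (A0 - s P)] is divisible by [s]; what is left after dividing is
   nonsingular at [s = 0] because [P] is definite on the kernel of [A0]. *)
Lemma pencil_multiplicity (A P : 'M[F]_n) (a : F) (t : nat) :
  A^T = A -> P^T = P -> (forall x, x != 0 -> 0 < qform P x) ->
  ('X - a%:P) ^+ t %| pencil_det A P ->
  (t <= \rank (kermx (A - a *: P)))%N.
Proof.
move=> symA symP posP; set A0 := A - a *: P => dvd_t.
have symA0 : A0^T = A0 by rewrite /A0 linearB linearZ /= symA symP.
set r := \rank A0; pose Y := invmx (col_ebase A0).
have Yu : Y \in unitmx by rewrite unitmx_inv col_ebase_unit.
have YA0 : Y *m A0 = pid_mx r *m row_ebase A0.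
  by rewrite -{1}(mulmx_ebase A0) -mulmxA mulKmx ?col_ebase_unit.
have YA0_0 (i : 'I_n) j : (r <= i)%N -> (Y *m A0) i j = 0.
  move=> ri; rewrite YA0 mxE big1 // => l _.
  by rewrite mxE [(i < r)%N]ltnNge ri andbF mul0r.
pose s : {poly F} := 'X - a%:P.
pose N : 'M[{poly F}]_n := \matrix_(i, j)
  if (i < r)%N then ((Y *m A0) i j)%:P - s * ((Y *m P) i j)%:P
  else - ((Y *m P) i j)%:P.
pose d : 'rV[{poly F}]_n := \row_i if (i < r)%N then 1 else s.
have AXP : map_mx polyC A - 'X *: map_mx polyC P =
    map_mx polyC A0 - s *: map_mx polyC P.
  apply/matrixP=> i j; rewrite !mxE /s rmorphB rmorphM /= mulrBl.
  by rewrite opprB addrA addrNK.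
have dN : map_mx polyC Y *m (map_mx polyC A - 'X *: map_mx polyC P) =
    diag_mx d *m N.
  rewrite AXP mulmxBr -scalemxAr -!map_mxM /=.
  apply/matrixP=> i j; rewrite mul_diag_mx !mxE.
  case: ltnP => [_|ri]; first by rewrite mul1r.
  by have := YA0_0 i j ri; rewrite mxE => ->; rewrite sub0r mulrN.
have detE : (\det Y)%:P * pencil_det A P = s ^+ (n - r) * \det N.
  rewrite /pencil_det -det_map_mx -det_mulmx dN det_mulmx det_diag.
  congr (_ * _); under eq_bigr => i _ do rewrite mxE.
  rewrite (bigID (fun i : 'I_n => (i < r)%N)) /= big1 => [|i ->//]; rewrite mul1r.
  under eq_bigr => i /negbTE -> do [].
  rewrite prodr_const; congr (_ ^+ _).
  have := cardC [pred i : 'I_n | (i < r)%N]; rewrite card_ord.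
  have -> : #|[pred i : 'I_n | (i < r)%N]| = r.
    by rewrite -[RHS](card_ord r) -sum1_card -sum1_card
      (big_ord_widen_cond n xpredT (fun=> 1%N)) ?rank_leq_row.
  by move/(canRL (addKn _)) <-; apply: eq_card => i; rewrite !inE.
(* If [t > n - r], cancelling [s ^+ (n - r)] still leaves a factor [s] in [\det N]. So [N] is
   singular at [a], and a vector [v] of its kernel there will contradict the positivity of [P]. *)
rewrite mxrank_ker -/r leqNgt; apply/negP => ltrt.
have : s ^+ (n - r).+1 %| s ^+ (n - r) * \det N.
  by rewrite -detE dvdp_mull // (dvdp_trans _ dvd_t) ?dvdp_exp2l.
rewrite exprSr dvdp_mul2l ?expf_neq0 ?polyXsubC_eq0 // dvdp_XsubCl /root.
rewrite -horner_evalE -det_map_mx; set N0 := map_mx _ N.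
have N0E i j : N0 i j = if (i < r)%N then (Y *m A0) i j else - (Y *m P) i j.
  rewrite mxE [N i j]mxE; case: ifP => _ /=; rewrite /horner_eval !hornerE //.
  by rewrite subrr mul0r oppr0 addr0.
rewrite -det_tr => /eqP/eqP/det0P[v v_neq0].
move/(congr1 trmx); rewrite trmx_mul trmxK trmx0 => N0v.
have YA0v : Y *m A0 *m v^T = 0.
  apply/colP=> i; case: (ltnP i r) => ri.
    rewrite -N0v [LHS]mxE [RHS]mxE; apply: eq_bigr => j _.
    by rewrite N0E ri.
  by rewrite [LHS]mxE [RHS]mxE big1 // => j _; rewrite YA0_0 // mul0r.
have A0v : v *m A0 = 0.
  apply: trmx_inj; rewrite trmx_mul symA0 trmx0.
  by rewrite -(mulKmx Yu (A0 *m _)) (mulmxA Y) YA0v mulmx0.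
have [w vE] : exists w, v = w *m Y by exists (v *m invmx Y); rewrite mulmxKV.
have w0 (i : 'I_n) : (i < r)%N -> w 0 i = 0.
  move=> ri; have : w *m (pid_mx r : 'M_n) = 0.
    rewrite -(mulmxK (row_ebase_unit A0) (w *m _)) -(mulmxA w) -YA0 mulmxA.
    by rewrite -vE A0v mul0mx.
  move/rowP/(_ i); rewrite !mxE (bigD1 i) //= big1 => [|j /negbTE nj].
    by rewrite mxE eqxx ri addr0 mulr1.
  by rewrite mxE val_eqE nj mulr0.
(* In [w (Y P v^T)] the entries of [w] before [r] vanish, and from [r] on the rows of [Y P] are
   those of [- N0], which annihilate [v^T]. *)
have : qform P v = 0.
  rewrite /qform {1}vE -!mulmxA mxE big1 // => i _.
  case: (ltnP i r) => ri; first by rewrite w0 ?mul0r.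
  rewrite [X in _ * X](_ : _ = - (N0 *m v^T) i 0).
    by rewrite N0v mxE oppr0 mulr0.
  rewrite mulmxA [LHS]mxE [X in - X]mxE -sumrN; apply: eq_bigr => j _.
  by rewrite N0E ltnNge ri mulNr opprK.
by move=> q0; have := posP v v_neq0; rewrite q0 ltxx.
Qed.


Variables (mass k b : 'I_n -> F).
Hypotheses (mass_gt0 : forall j, 0 < mass j) (k_gt0 : forall j, 0 < k j)
  (b_ge0 : forall j, 0 <= b j).
Let K := chain_mx k.
Let P := mass_mx mass + chain_mx b.

Lemma qform_mass_gt0 x : x != 0 -> 0 < qform (mass_mx mass) x.
Proof.
move=> /rV0Pn[j xj]; rewrite qform_mass (bigD1 j) //= ltr_wpDr //.
  by apply: sumr_ge0 => i _; rewrite mulr_ge0 ?sqr_ge0 // ltW.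
by rewrite mulr_gt0 // exprn_even_gt0.
Qed.

Lemma inertia_gt0 x : x != 0 -> 0 < qform P x.
Proof.
move=> x0; rewrite qformD ltr_wpDr ?qform_mass_gt0 // qform_chain.
by apply: sumr_ge0 => j _; rewrite mulr_ge0 ?sqr_ge0.
Qed.

Lemma inertia_sym : P^T = P.
Proof. by rewrite linearD /= mass_mx_sym chain_mx_sym. Qed.

Lemma inertia_unit : P \in unitmx.
Proof.
rewrite unitmxE unitfE; apply/det0P => -[x /inertia_gt0 + xP].
by rewrite /qform xP mul0mx mxE ltxx.
Qed.

(* A kernel vector of a tridiagonal matrix is determined by its entries at the
   first index and after the vanishing off-diagonal entries. *)
Lemma chain_nullity a :
  (\rank (kermx (K - a *: P)) <= #|[set j | (k j == a * b j)%R]|.+1)%N.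
Proof.
set Z := [set j | _]; pose S := Z :|: [set j : 'I_n | j == 0 :> nat].
have cardS : (#|S| <= #|Z|.+1)%N.
  rewrite (leq_trans (leq_card_setU _ _)) // -addn1 leq_add2l.
  apply/card_le1_eqP => i j; rewrite !inE => /eqP i0 /eqP j0.
  by apply: val_inj; rewrite /= i0.
apply: leq_trans cardS; apply: (@rank_le_card _ _ _ _ _ 1%:M) => x xK xS.
have {}xK : x *m (K - a *: P) = 0 by apply/sub_kermxP.
suff x0 d (j : 'I_n) : (j <= d)%N -> x 0 j = 0.
  by apply/rowP=> j; rewrite (x0 j) ?mxE.
elim: d j => [|d IHd] j jd; have := xS j; rewrite mulmx1 !inE.
  by apply; rewrite -leqn0 jd orbT.
case: eqP => [_ -> //|/eqP kj]; case: eqP => [_ -> //|/eqP j0 _].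
have [j' jE] : exists j' : 'I_n, j = j'.+1 :> nat.
  have lt_j1 : (j.-1 < n)%N by rewrite (leq_ltn_trans (leq_pred _)).
  by exists (Ordinal lt_j1); rewrite /= prednK ?lt0n.
(* With the entries of [x] before [j] already zero, column [j - 1] of [x (K - a P) = 0] reduces to
   [x_j (a b_j - k_j) = 0]. *)
move/rowP/(_ j'): xK; rewrite !mxE (bigD1 j) //= big1 => [|i ij]; last first.
  case: (ltnP i j) => [lt_ij|le_ji].
    by rewrite IHd ?mul0r // -ltnS (leq_trans lt_ij).
  have lt_ji : (j < i)%N by rewrite ltn_neqAle le_ji eq_sym ij.
  rewrite !mxE -!val_eqE /=.
  have /gtn_eqF -> : (j' < i)%N by rewrite (ltn_trans _ lt_ji) // jE.
  have /ltn_eqF -> : (j' < i.+1)%N by rewrite leqW // (ltn_trans _ lt_ji) // jE.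
  have /gtn_eqF -> : (j'.+1 < i)%N by rewrite -jE.
  by rewrite mulr0n addr0 mulr0 subr0 mulr0.
rewrite addr0 !mxE -!val_eqE /= jE.
have -> : (j'.+1 == j' :> nat) = false by rewrite gtn_eqF.
have -> : (j' == j'.+2 :> nat) = false by rewrite ltn_eqF // leqW.
rewrite eqxx mulr0n add0r mulrN opprK.
rewrite addrC => /eqP; rewrite mulf_eq0 subr_eq0 [_ * _ == _]eq_sym (negbTE kj) orbF.
by move/eqP.
Qed.

Variables (m : nat) (lam : 'I_m -> F) (t : 'I_m -> nat).
Hypotheses (lam_gt0 : forall i, 0 < lam i)
  (lam_incr : forall i j : 'I_m, (i < j)%N -> lam i < lam j)
  (dvd_t : forall i, ('X - (lam i)%:P) ^+ t i %| pencil_det K P).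

Let lam_inj : injective lam.
Proof.
move=> i j eq_ij; apply/val_inj; case: (ltngtP i j) => // /lam_incr.
  by rewrite eq_ij ltxx.
by rewrite eq_ij ltxx.
Qed.

(** Going through [K *m invmx P] makes the directness of sums of eigenspaces available for the
    pencil. *)
Let E (i : 'I_m) := eigenspace (K *m invmx P) (lam i).

Let sub_E p i (x : 'M_(p, n)) : (x <= E i)%MS = (x *m K == lam i *: (x *m P)).
Proof.
apply/eigenspaceP/eqP => [xE|xE].
  by rewrite -[x *m K](mulmxKV inertia_unit) -(mulmxA x) xE -scalemxAl.
by rewrite mulmxA xE -scalemxAl mulmxK ?inertia_unit.
Qed.

Let rank_E i : (t i <= \rank (E i))%N.
Proof.
rewrite (leq_trans (pencil_multiplicity _ _ inertia_gt0 (dvd_t i))) //.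
- exact: chain_mx_sym.
- exact: inertia_sym.
rewrite mxrankS // sub_E.
by rewrite scalemxAr -subr_eq0 -mulmxBr mulmx_ker.
Qed.

(** Since [K] and [P] are symmetric, eigenvectors for distinct [lam l] are [P]-orthogonal, and the
    cross terms vanish. *)
Let qform_sum_E i (u : 'I_m -> 'rV_n) :
  (forall l, (u l <= E l)%MS) ->
  qform (K - lam i *: P) (\sum_(l < m | (i <= l)%N) u l) =
  \sum_(l < m | (i <= l)%N) (lam l - lam i) * qform P (u l).
Proof.
move=> uE.
have uK l : u l *m K = lam l *: (u l *m P) by apply/eqP; rewrite -sub_E.
have ortho l l' : l != l' -> u l *m P *m (u l')^T = 0.
  move=> nll'; apply/eqP; have : lam l *: (u l *m P *m (u l')^T) =
      lam l' *: (u l *m P *m (u l')^T).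
    rewrite scalemxAl -uK; apply: trmx_inj.
    rewrite !linearZ /= !trmx_mul !trmxK inertia_sym chain_mx_sym !mulmxA uK.
    by rewrite -scalemxAl.
  move/eqP; rewrite -subr_eq0 -scalerBl scaler_eq0 subr_eq0.
  by rewrite (inj_eq lam_inj) (negbTE nll').
rewrite /qform mulmx_suml linear_sum /= mulmx_sumr summxE.
apply: eq_bigr => l il; rewrite mulmx_suml (bigD1 l) //= big1 => [|l' /andP[_ nl']].
  by rewrite addr0 mulmxBr uK -scalemxAr -scalerBl -scalemxAl mxE.
by rewrite mulmxBr uK -scalemxAr -scalerBl -scalemxAl ortho ?scaler0.
Qed.

(* On the sum of the eigenspaces of [lam l], [i <= l], the form of
   [K - lam i P] is nonnegative, whereas it is negative on the vectors that
   do not stretch the links with [lam i * b j < k j]. *)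
Lemma multiplicity_sum (i : 'I_m) :
  (\sum_(l < m | i <= l) t l <= #|[set j | (lam i * b j < k j)%R]|)%N.
Proof.
pose V := (\sum_(l < m | (i <= l)%N) E l)%MS.
have rV : (\sum_(l < m | (i <= l)%N) t l <= \rank V)%N.
  have /mxdirectP /= -> : mxdirect (\sum_(l < m | (i <= l)%N) E l).
    by apply: mxdirect_sum_eigenspace => ? ? _ _ /lam_inj.
  by apply: leq_sum => l _; apply: rank_E.
apply: leq_trans rV _; apply: (@rank_le_card _ _ _ _ _ (diff_mx F n)) => x.
move=> /sub_sumsmxP[u xu] xS; apply/eqP/negPn/negP => x_neq0.
have : 0 <= qform (K - lam i *: P) x.
  rewrite xu qform_sum_E => [|l]; last exact: submxMl.
  apply: sumr_ge0 => l il; rewrite mulr_ge0 //.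
    move: il; rewrite subr_ge0 leq_eqVlt => /predU1P[/val_inj->//|/lam_incr].
    exact: ltW.
  have [->|/inertia_gt0/ltW//] := eqVneq (u l *m E l) 0.
  by rewrite /qform !mul0mx mxE.
(* The form splits into [- lam i] times the mass form, which is negative, and the sum of
   [(k j - lam i * b j)] times squared elongations, where each term is zero or has a nonpositive
   coefficient. *)
rewrite qformB qformZ qformD mulrDr opprD addrCA addrC !qform_chain.
rewrite mulr_sumr -sumrB leNgt => /negP[].
rewrite ltr_wnDl ?oppr_lt0 ?mulr_gt0 ?qform_mass_gt0 //.
apply: sumr_le0 => j _; rewrite mulrA -mulrBl.
case: (ltP (lam i * b j) (k j)) => jS.
  by rewrite xS ?inE // expr0n mulr0.
by rewrite mulr_le0_ge0 ?sqr_ge0 // subr_le0.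
Qed.

Lemma multiplicity_le (i : 'I_m) :
  (\sum_(l < m) t l)%N = n -> (forall l, 0 < t l)%N -> (t i <= i.+1)%N.
Proof.
move=> sum_t t_gt0.
pose Z l := [set j | (k j == lam l * b j)%R].
have tZ l : ((t l).-1 <= #|Z l|)%N.
  have tr : (t l <= #|Z l|.+1)%N.
    rewrite (leq_trans (rank_E l)) // (leq_trans _ (chain_nullity (lam l))) //.
    rewrite mxrankS //; apply/sub_kermxP.
    by rewrite mulmxBr -scalemxAr; apply/eqP; rewrite subr_eq0 -sub_E.
  by rewrite -ltnS prednK.
pose S := [set j | (lam i * b j < k j)%R].
have sumZ : (\sum_(l < m | l <= i) #|Z l| <= #|~: S|)%N.
  pose T := [set p : 'I_m * 'I_n | (p.1 <= i)%N && (p.2 \in Z p.1)].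
  have -> : (\sum_(l < m | l <= i) #|Z l| = #|T|)%N.
    under eq_bigr => l _ do rewrite -sum1_card.
    rewrite pair_big_dep /= -[RHS]sum1_card; apply: eq_bigl => p /=.
    by rewrite [RHS]inE.
  (* The sets [Z l] are disjoint: [k j = lam l * b j] with [k j > 0] forces [b j != 0], so [j]
     determines [lam l]. *)
  rewrite -(card_in_imset (f := snd)) => [|[l j] [l' j']]; last first.
    rewrite !inE /= => /andP[_ /eqP kj] /andP[_ /eqP kj'] jj'.
    rewrite -jj' in kj' *; congr (_, _); apply: lam_inj.
    apply: (@mulIf _ (b j)); last by rewrite -kj.
    by apply: contraTneq (k_gt0 j) => bj; rewrite kj bj mulr0 ltxx.
  apply/subset_leq_card/fintype.subsetP => j /imsetP[[l j'] + ->].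
  rewrite !inE /= => /andP[li /eqP kj]; rewrite -leNgt kj ler_wpM2r //.
  by move: li; rewrite leq_eqVlt => /predU1P[/val_inj->//|/lam_incr/ltW].
have splitn : n = (\sum_(l < m | i <= l) t l + \sum_(l < m | l < i) t l)%N.
  rewrite -[LHS]sum_t (bigID (fun l : 'I_m => (i <= l)%N)) /=; congr (_ + _)%N.
  by apply: eq_bigl => l; rewrite ltnNge.
have := leq_add (multiplicity_sum i) sumZ.
rewrite cardsC card_ord => /leq_trans/(_ (eq_leq splitn)).
rewrite leq_add2l; move: (@leq_sum _ (index_enum 'I_m) (fun l : 'I_m => (l <= i)%N)
  _ _ (fun l _ => tZ l)) => le_t /(leq_trans le_t) {le_t}.
(* Cancelling the [t l - 1] with [l < i] on both sides leaves [t i - 1] at most the number of such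
   [l], which is [i] as indices start at 0. *)
have tE (l : 'I_m) : t l = ((t l).-1 + 1)%N by rewrite addn1 prednK.
rewrite (bigD1 i) //= (eq_bigl (fun l : 'I_m => (l < i)%N)); last first.
  by move=> l; rewrite ltn_neqAle andbC.
under [X in (_ <= X)%N]eq_bigr => l _ do rewrite tE.
rewrite big_split /= addnC leq_add2l sum1_card => ti.
rewrite -(prednK (t_gt0 i)) ltnS (leq_trans ti) //.
rewrite -sum1_card -(big_ord_widen_cond m xpredT (fun=> 1%N)) ?sum1_card ?card_ord //.
exact: ltnW.
Qed.

End Pencil.

(** * Characteristic polynomials of a chain *)

(** The continuant recurrence: expand along the last row, then expand the off-diagonal minor along
    its last column. *)
Lemma det_tridiag (A : comNzRingType) (f : nat -> nat -> A) (n : nat) :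
  (forall i j, (i.+1 < j)%N || (j.+1 < i)%N -> f i j = 0) ->
  \det (\matrix_(i < n.+2, j < n.+2) f i j) =
  f n.+1 n.+1 * \det (\matrix_(i < n.+1, j < n.+1) f i j)
  - f n.+1 n * f n n.+1 * \det (\matrix_(i < n, j < n) f i j).
Proof.
move=> f0; rewrite (expand_det_row _ ord_max) !big_ord_recr /= big1 ?add0r; last first.
  by move=> i _; rewrite mxE f0 ?mul0r //= !ltnS ltn_ord orbT.
rewrite !mxE /= addrC; congr (_ + _).
  rewrite /cofactor /= addnn -signr_odd odd_double expr0 mul1r; congr (_ * \det _).
  by apply/matrixP => i j; rewrite !mxE !lift_max.
rewrite -mulrA -mulrN; congr (_ * _).
rewrite /cofactor /= addSn addnn -signr_odd /= odd_double expr1 mulN1r; congr (- _).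
rewrite (expand_det_col _ ord_max) big_ord_recr /= big1 ?add0r => [|i _].
  rewrite !mxE !lift_max /= /bump leqnn add1n; congr (_ * _).
  rewrite /cofactor /= addnn -signr_odd odd_double expr0 mul1r; congr (\det _).
  apply/matrixP => i j; rewrite !mxE !lift_max /= /bump.
  by rewrite !(leqNgt n j) !ltn_ord /= !add0n (leqNgt n j) ltn_ord.
rewrite !mxE !lift_max /= /bump leqnn add1n f0 ?mul0r // !ltnS.
by rewrite ltn_ord.
Qed.

Section Chain.
Variables (F : numDomainType) (mass k b : nat -> F).

Definition link j : {poly F} := (k j)%:P - b j *: 'X.

(* The characteristic polynomials (free end, end mass clamped) of the chain
   made of the first [n] masses. *)
Fixpoint chain_poly n : {poly F} * {poly F} :=
  if n is j.+1 then
    let p := chain_poly j in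
    let E := p.1 + link j * p.2 in (link j * p.1 - mass j *: ('X * E), E)
  else (1, 0).

Lemma chain_poly1S j : (chain_poly j.+1).1 =
  link j * (chain_poly j).1 - mass j *: ('X * (chain_poly j.+1).2).
Proof. by []. Qed.

Lemma chain_poly2S j :
  (chain_poly j.+1).2 = (chain_poly j).1 + link j * (chain_poly j).2.
Proof. by []. Qed.

Let pencil_entry i j : {poly F} :=
  if i == j then link i + link i.+1 - mass i *: 'X
  else if j == i.+1 then - link j else if i == j.+1 then - link i else 0.

Let pencil_entry0 i j : (i.+1 < j)%N || (j.+1 < i)%N -> pencil_entry i j = 0.
Proof.
move=> ij; rewrite /pencil_entry; case: eqVneq => [eq_ij|_].
  by move: ij; rewrite eq_ij ltnNge leqnSn.
case: eqVneq => [eq_ij|_]; first by move: ij; rewrite eq_ij ltnn /= ltnNge !leqW.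
by case: eqVneq => // eq_ij; move: ij; rewrite eq_ij ltnn orbF ltnNge !leqW.
Qed.

(** When the last of [n.+1] masses is clamped, the first [n] still feel link [n] in their last
    diagonal entry; hence the shift of index. Two consecutive orders are carried along because the
    recurrence has three terms. *)
Let det_clamped n :
  \det (\matrix_(i < n, j < n) pencil_entry i j) = (chain_poly n.+1).2.
Proof.
suff : \det (\matrix_(i < n, j < n) pencil_entry i j) = (chain_poly n.+1).2 /\
  \det (\matrix_(i < n.+1, j < n.+1) pencil_entry i j) = (chain_poly n.+2).2.
  by case.
elim: n => [|n [IHn IHn1]].
  rewrite det_mx00 /= mulr0 addr0; split=> //.
  by rewrite det_mx11 mxE /pencil_entry eqxx /= mulr1 -!mul_polyC; ring.
split=> //; rewrite det_tridiag // IHn IHn1 /pencil_entry !eqxx.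
rewrite (gtn_eqF (leqnn n.+1)) (ltn_eqF (leqnn n.+1)).
rewrite (ltn_eqF (leqW (leqnn n.+1))).
rewrite (chain_poly2S n.+2) (chain_poly1S n.+1) (chain_poly2S n.+1).
by rewrite -!mul_polyC; ring.
Qed.

(** Only the last diagonal entry differs from [pencil_entry], no link following it. The proper
    leading minors are therefore clamped polynomials, and one use of the continuant recurrence gives
    the free one. *)
Lemma pencil_det_chain n :
  pencil_det (chain_mx (fun i : 'I_n => k i))
    (mass_mx (fun i : 'I_n => mass i) + chain_mx (fun i : 'I_n => b i)) =
  (chain_poly n).1.
Proof.
pose entry i j : {poly F} :=
  if (i.+1 == n) && (j.+1 == n) then link i - mass i *: 'X else pencil_entry i j.
have -> : pencil_det (chain_mx (fun i : 'I_n => k i))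
    (mass_mx (fun i : 'I_n => mass i) + chain_mx (fun i : 'I_n => b i)) =
    \det (\matrix_(i < n, j < n) entry i j).
  congr (\det _); apply/matrixP=> i j; rewrite !mxE /entry /pencil_entry -val_eqE /=.
  have nextE (c : nat -> F) : next_coef (fun i : 'I_n => c i) i =
      if i.+1 == n then 0 else c i.+1.
    rewrite /next_coef; case: insubP => [l /= lt_i ->|]; first by rewrite ltn_eqF.
    by rewrite -leqNgt => /= le_n; rewrite eqn_leq ltn_ord le_n.
  rewrite !nextE {nextE}; case: (eqVneq (i : nat) j) => [->|nij].
    rewrite andbb /link mulr1n; case: ifP => _; rewrite !polyCD -!mul_polyC ?polyC0; ring.
  have -> : (i.+1 == n) && (j.+1 == n) = false.
    apply/negP => /andP[/eqP i1 /eqP j1].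
    by move: nij; rewrite -eqSS i1 j1 eqxx.
  rewrite mulr0n add0r; case: eqP => _; last case: eqP => _.
  - by rewrite /link !polyCN -!mul_polyC; ring.
  - by rewrite /link !polyCN -!mul_polyC; ring.
  by rewrite !polyC0 mulr0 subr0.
have minor p : (p < n)%N -> \det (\matrix_(i < p, j < p) entry i j) =
    (chain_poly p.+1).2.
  move=> pn; rewrite -det_clamped; congr (\det _); apply/matrixP=> i j; rewrite !mxE.
  by rewrite /entry [_ == n]ltn_eqF // (leq_ltn_trans (ltn_ord i)).
have entry0 i j : (i.+1 < j)%N || (j.+1 < i)%N -> entry i j = 0.
  move=> ij; rewrite /entry; case: ifP => [/andP[/eqP <- /eqP[eq_ij]]|_].
    by move: ij; rewrite eq_ij ltnNge leqnSn.
  exact: pencil_entry0.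
case: n @entry minor entry0 => [|[|n]] entry minor entry0.
- by rewrite det_mx00.
- by rewrite det_mx11 mxE /entry /= mulr1 mulr0 addr0 mulr1.
rewrite det_tridiag // !minor // /entry !eqxx /= !eqSS /pencil_entry.
rewrite (gtn_eqF (leqnn n.+1)) (ltn_eqF (leqnn n.+1)) /=.
rewrite (ltn_eqF (leqW (leqnn n.+1))) !eqxx /=.
by rewrite -!mul_polyC; ring.
Qed.

End Chain.

(** * Splitting masses and links off the free end *)

Section Realizable.
Variable R : realType.
Implicit Types (g D E p q : {poly R}) (n h : nat).

(* [g] is the common factor of the two characteristic polynomials, coming from
   the modes in which the end mass does not move. *)
Definition realizable n g D E : Prop :=
  exists mass k b : nat -> R,
    [/\ forall j, 0 < mass j, forall j, 0 < k j, forall j, 0 <= b j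
      & exists a c : R, [/\ 0 < a, 0 < c
        & chain_poly mass k b n = (a *: (g * D), c *: (g * E))]].

Lemma realizable_scale n g D E x y : 0 < x -> 0 < y ->
  realizable n g D E -> realizable n g (x *: D) (y *: E).
Proof.
move=> x0 y0 [mass [k [b [mass0 k0 b0 [a [c [a0 c0 chainE]]]]]]].
exists mass, k, b; split=> //; exists (a / x), (c / y).
rewrite !divr_gt0 //; split=> //; rewrite chainE.
by rewrite -!scalerAr !scalerA !divfK ?gt_eqF.
Qed.

Lemma realizable0 x : 0 < x -> realizable 0 1 x%:P 0.
Proof.
move=> x0; exists (fun=> 1), (fun=> 1), (fun=> 0); split=> //.
exists x^-1, 1; split=> //; first by rewrite invr_gt0.
by rewrite mulr0 scaler0 mul1r -mul_polyC -polyCM mulVf ?gt_eqF.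
Qed.

Lemma eq_chain_poly (mass k b mass' k' b' : nat -> R) n :
  (forall j, (j < n)%N -> [/\ mass j = mass' j, k j = k' j & b j = b' j]) ->
  chain_poly mass k b n = chain_poly mass' k' b' n.
Proof.
elim: n => // n IHn eq_n /=; rewrite /link.
have [-> -> ->] := eq_n n (leqnn _); rewrite IHn // => j jn.
by apply: eq_n; rewrite leqW.
Qed.

(** One step of [chain_poly]. The scales [x] and [y] of the shorter chain are not under control, so
    the new mass and link are chosen after them. *)
Lemma realizable_next n g D E g' D' E' :
  (forall x y : R, 0 < x -> 0 < y -> exists mn kn bn a c : R,
    [/\ [/\ 0 < mn, 0 < kn, 0 <= bn, 0 < a & 0 < c],
        c *: (g' * E') = x *: (g * D) + (kn%:P - bn *: 'X) * (y *: (g * E))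
      & a *: (g' * D') = (kn%:P - bn *: 'X) * (x *: (g * D))
                         - mn *: ('X * (c *: (g' * E')))]) ->
  realizable n g D E -> realizable n.+1 g' D' E'.
Proof.
move=> next [mass [k [b [mass0 k0 b0 [x [y [x0 y0 chainE]]]]]]].
have [mn [kn [bn [a [c [[mn0 kn0 bn0 a0 c0] cE aD]]]]]] := next _ _ x0 y0.
pose upd (f : nat -> R) v j := if j == n then v else f j.
exists (upd mass mn), (upd k kn), (upd b bn).
split; try by move=> j; rewrite /upd; case: ifP.
exists a, c; split=> //=; rewrite /link /upd eqxx.
rewrite (@eq_chain_poly _ _ _ mass k b) => [|j jn]; last by rewrite ltn_eqF.
by rewrite chainE /= aD cE.
Qed.

Lemma realizable_spring n g D E c k : 0 < c -> 0 < k ->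
  realizable n g (D + c *: ('X * E)) (E - k^-1 *: (D + c *: ('X * E))) ->
  realizable n.+1 g D E.
Proof.
move=> c0 k0; apply: realizable_next => x y x0 y0.
(* The stiffness [kn] satisfies [kn * y = k * x], which cancels the terms in [D + c X E] from the
   clamped polynomial. *)
exists (c * (x / y)), (k * (x / y)), 0, (k * x * (x / y)), (x * k).
rewrite !(mulr_gt0, invr_gt0) //; split=> //.
  have kk : k%:P * k^-1%:P = 1 :> {poly R} by rewrite -polyCM divff ?gt_eqF.
  have xy : (k * (x / y))%:P * y%:P = k%:P * x%:P :> {poly R}.
    by rewrite -!polyCM -mulrA divfK ?gt_eqF.
  rewrite -!mul_polyC polyC0 mul0r subr0 !polyCM.
  transitivity (x%:P * (g * (D + c%:P * ('X * E))) + (k * (x / y))%:P * y%:P *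
    (g * E - g * k^-1%:P * (D + c%:P * ('X * E)))).
    rewrite xy; transitivity (x%:P * k%:P * (g * E) + (1 - k%:P * k^-1%:P) *
      (x%:P * (g * (D + c%:P * ('X * E))))); last by ring.
    by rewrite kk; ring.
  by rewrite !polyCM; ring.
by rewrite -!mul_polyC !polyCM polyC0; ring.
Qed.

(** With link [s (nu - X)], both terms of the new clamped polynomial are divisible by [nu - X],
    which thus joins the common factor. The value of [s] comes from [s * y * rho = x], which cancels
    the terms in [Q]. *)
Lemma realizable_tank n g D E Q w rho (nu : R) : 0 < w -> 0 < rho -> 0 < nu ->
  D + w *: ('X * E) = (nu%:P - 'X) * Q ->
  realizable n g (D + w *: ('X * E)) (E - rho *: Q) ->
  realizable n.+1 ((nu%:P - 'X) * g) D E.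
Proof.
move=> w0 rho0 nu0 DQ; rewrite DQ; apply: realizable_next => x y x0 y0.
pose s := x / (y * rho); have s0 : 0 < s by rewrite divr_gt0 ?mulr_gt0.
have yr : s * y * rho = x by rewrite -mulrA divfK // gt_eqF ?mulr_gt0.
exists (w * (x / y)), (s * nu), s, (s * x), (s * y).
rewrite !(mulr_gt0, invr_gt0) //; split=> //; first by split=> //; exact: ltW.
  rewrite -!mul_polyC -{1}yr !polyCM; ring.
have -> : D = (nu%:P - 'X) * Q - w *: ('X * E) by rewrite -DQ addrK.
have -> : w * (x / y) = w * (rho * s).
  by rewrite /s; field; rewrite ?gt_eqF.
rewrite -!mul_polyC -yr !polyCM; ring.
Qed.

End Realizable.

(** * Robust realizability *)

Section CoefConvergence.
Local Open Scope classical_set_scope.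
Variable R : realType.
Implicit Types p q : {poly R}.

Definition pcvg (ps : nat -> {poly R}) p : Prop := forall i, (ps n)`_i @[n --> \oo] --> p`_i.

Lemma pcvg_cst p : pcvg (fun=> p) p.
Proof. by move=> i; apply: cvg_cst. Qed.

Lemma pcvgD ps qs p q : pcvg ps p -> pcvg qs q ->
  pcvg (fun n => ps n + qs n) (p + q).
Proof. by move=> pp qq i; under eq_fun do rewrite coefD; rewrite coefD; apply: cvgD. Qed.

Lemma pcvgZ xs (x : R) ps p : xs n @[n --> \oo] --> x -> pcvg ps p ->
  pcvg (fun n => xs n *: ps n) (x *: p).
Proof. by move=> xx pp i; under eq_fun do rewrite coefZ; rewrite coefZ; apply: cvgM. Qed.

Lemma pcvgB ps qs p q : pcvg ps p -> pcvg qs q ->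
  pcvg (fun n => ps n - qs n) (p - q).
Proof. by move=> pp qq i; under eq_fun do rewrite coefB; rewrite coefB; apply: cvgB. Qed.

Lemma pcvgXM ps p : pcvg ps p -> pcvg (fun n => 'X * ps n) ('X * p).
Proof.
move=> pp [|i].
  by under eq_fun do rewrite coefXM; rewrite coefXM; apply: cvg_cst.
by under eq_fun do rewrite coefXM; rewrite coefXM; apply: pp.
Qed.

Lemma cvg_sum_ord N (f : nat -> nat -> R) (l : nat -> R) :
  (forall i, f i n @[n --> \oo] --> l i) ->
  \sum_(i < N) f i n @[n --> \oo] --> \sum_(i < N) l i.
Proof.
move=> fl; elim: N => [|N IHN].
  rewrite big_ord0 (_ : (fun n => _) = fun=> 0); first exact: cvg_cst.
  by apply/funext => n; rewrite big_ord0.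
rewrite big_ord_recr (_ : (fun n => _) = fun n => \sum_(i < N) f i n + f N n).
  exact: cvgD.
by apply/funext => n; rewrite big_ord_recr.
Qed.

Lemma pcvg_horner N (ps : nat -> {poly R}) p xs (x : R) :
  (forall n, (size (ps n) <= N)%N) -> (size p <= N)%N ->
  pcvg ps p -> xs n @[n --> \oo] --> x -> (ps n).[xs n] @[n --> \oo] --> p.[x].
Proof.
move=> sps sp pp xx; rewrite (horner_coef_wide _ sp).
rewrite (_ : (fun n => (ps n).[xs n]) =
    fun n => \sum_(i < N) (ps n)`_i * xs n ^+ i); last first.
  by apply/funext => n; rewrite (horner_coef_wide _ (sps n)).
apply: (@cvg_sum_ord N (fun i n => (ps n)`_i * xs n ^+ i)
  (fun i => p`_i * x ^+ i)) => i.
apply: cvgM (pp i) _; elim: i => [|j IHj]; first exact: cvg_cst.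
by under eq_fun do rewrite exprS; rewrite exprS; apply: cvgM.
Qed.

(** The coefficients of the quotient follow from the top down by [q_j = x q_(j+1) - p_(j+1)],
    starting from zero at the degree bound [N]. *)
Lemma pcvg_divXsub N (ps : nat -> {poly R}) p (qs : nat -> {poly R}) q xs (x : R) :
  (forall n, (size (qs n) <= N)%N) -> (size q <= N)%N ->
  (forall n, ps n = ((xs n)%:P - 'X) * qs n) -> p = (x%:P - 'X) * q ->
  pcvg ps p -> xs n @[n --> \oo] --> x -> pcvg qs q.
Proof.
move=> sq_ sq pq_ pq pp xx.
have rec (y : R) (r : {poly R}) j : r`_j = y * r`_j.+1 - ((y%:P - 'X) * r)`_j.+1.
  by rewrite mulrBl coefB coefCM coefXM opprB addrCA subrr addr0.
suff cvg_ d j : (N <= j + d)%N -> (qs n)`_j @[n --> \oo] --> q`_j.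
  by move=> j; apply: (cvg_ N); rewrite leq_addl.
elim: d j => [|d IHd] j Nj.
  rewrite addn0 in Nj; have q0 (r : {poly R}) : (size r <= N)%N -> r`_j = 0.
    by move=> sr; rewrite nth_default // (leq_trans sr).
  rewrite q0 // (_ : (fun n => _) = fun=> 0); first exact: cvg_cst.
  by apply/funext => n; rewrite q0.
rewrite (rec x) -pq (_ : (fun n => _) =
    fun n => xs n * (qs n)`_j.+1 - (ps n)`_j.+1); last first.
  by apply/funext => n; rewrite [LHS](rec (xs n)) -pq_.
by apply: cvgB => //; apply: cvgM => //; apply: IHd; rewrite addSnnS.
Qed.

Lemma pcvg_near N (ps : nat -> {poly R}) p (d : R) : 0 < d ->
  (forall n, (size (ps n) <= N)%N) -> (size p <= N)%N -> pcvg ps p ->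
  \forall n \near \oo, forall i, `|(ps n)`_i - p`_i| < d.
Proof.
move=> d0 sp_ sp pp.
have : \forall n \near \oo, forall i : 'I_N, `|(ps n)`_i - p`_i| < d.
  apply: filter_forall => i.
  have /cvgrPdist_lt/(_ d d0) := pp i.
  by apply: filterS => n; rewrite distrC.
apply: filterS => n lt_d i; have [iN|Ni] := ltnP i N.
  exact: (lt_d (Ordinal iN)).
by rewrite !nth_default ?subrr ?normr0 // (leq_trans _ Ni).
Qed.

Lemma pcvg_dist (ps : nat -> {poly R}) p (xs : nat -> R) : xs n @[n --> \oo] --> 0 ->
  (forall n i, `|(ps n)`_i - p`_i| <= xs n) -> pcvg ps p.
Proof.
move=> x0 le_x i; apply/cvgrPdist_lt => e e0.
have /cvgrPdist_lt/(_ e e0) := x0; apply: filterS => n.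
rewrite sub0r normrN => lt_e; rewrite distrC (le_lt_trans (le_x n i)) //.
by rewrite (le_lt_trans (ler_norm _)).
Qed.

End CoefConvergence.

Section Robust.
Local Open Scope classical_set_scope.
Variable R : realType.
Implicit Types (g D E p q : {poly R}) (n h : nat).

(** Realizability on a neighbourhood of [(D, E)] among pairs of degrees at most [h] and below [h].
    Here [h] is the degree left once the common factor [g] is removed, while [n] counts the
    masses. *)
Definition robust h n g D E : Prop :=
  exists2 d : R, 0 < d & forall D' E', (size D' <= h.+1)%N -> (size E' <= h)%N ->
    (forall i, `|D'`_i - D`_i| < d) -> (forall i, `|E'`_i - E`_i| < d) ->
    realizable n g D' E'.

Lemma robust_realizable h n g D E : (size D <= h.+1)%N -> (size E <= h)%N ->
  robust h n g D E -> realizable n g D E.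
Proof.
by move=> sD sE [d d0]; apply=> // i; rewrite subrr normr0.
Qed.

Lemma robust_near N h n g D E (Ds Es : nat -> {poly R}) :
  (forall i, (size (Ds i) <= N)%N) -> (forall i, (size (Es i) <= N)%N) ->
  (size D <= N)%N -> (size E <= N)%N -> pcvg Ds D -> pcvg Es E ->
  robust h n g D E -> \forall i \near \oo, robust h n g (Ds i) (Es i).
Proof.
move=> sD_ sE_ sD sE DD EE [d d0 real_d].
have d2 : 0 < d / 2 by rewrite divr_gt0.
have := pcvg_near d2 sE_ sE EE; apply: filterS2 (pcvg_near d2 sD_ sD DD) => i.
move=> Di Ei; exists (d / 2) => // D' E' sD' sE' DD' EE'; apply: real_d => // j.
  by rewrite -(subrKA (Ds i)`_j) [d]splitr (le_lt_trans (ler_normD _ _)) ?ltrD.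
by rewrite -(subrKA (Es i)`_j) [d]splitr (le_lt_trans (ler_normD _ _)) ?ltrD.
Qed.

(** If robustness failed, choosing a bad pair within [1 / (i + 1)] for every [i] would give a
    convergent sequence with no realizable term. *)
Lemma robust_seq h n g D E :
  (forall Ds Es : nat -> {poly R}, (forall i, (size (Ds i) <= h.+1)%N) ->
     (forall i, (size (Es i) <= h)%N) -> pcvg Ds D -> pcvg Es E ->
     exists i : nat, realizable n g (Ds i) (Es i)) ->
  robust h n g D E.
Proof.
move=> real_seq; apply: contrapT => notrob.
have bad (i : nat) : exists p : {poly R} * {poly R},
    [/\ (size p.1 <= h.+1)%N, (size p.2 <= h)%N,
        forall j, `|p.1`_j - D`_j| <= i.+1%:R^-1,
        forall j, `|p.2`_j - E`_j| <= i.+1%:R^-1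
      & ~ realizable n g p.1 p.2].
  apply: contrapT => nobad; apply: notrob; exists i.+1%:R^-1.
    by rewrite invr_gt0 ltr0n.
  move=> D' E' sD' sE' DD' EE'; apply: contrapT => nreal; apply: nobad.
  by exists (D', E'); split=> // j /=; apply: ltW.
have [f fP] := choice bad.
have [] := real_seq (fun i => (f i).1) (fun i => (f i).2).
- by move=> i; case: (fP i).
- by move=> i; case: (fP i).
- by apply: (pcvg_dist cvg_harmonic) => i j; case: (fP i).
- by apply: (pcvg_dist cvg_harmonic) => i j; case: (fP i).
by move=> i; case: (fP i).
Qed.

Lemma robust_scale h n g D E x y : 0 < x -> 0 < y ->
  robust h n g D E -> robust h n g (x *: D) (y *: E).
Proof.
move=> x0 y0 [d d0 real_d].
have scale_dist (p q : {poly R}) (z : R) i : 0 < z ->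
    `|p`_i - (z *: q)`_i| < z * d -> `|(z^-1 *: p)`_i - q`_i| < d.
  move=> z0 lt_d; rewrite -(ltr_pM2l z0) -{1}(gtr0_norm z0) -normrM coefZ.
  by rewrite mulrBr mulVKf ?gt_eqF // -coefZ.
exists (Num.min (x * d) (y * d)); first by rewrite lt_min !mulr_gt0.
move=> D' E' sD' sE' DD' EE'.
have -> : D' = x *: (x^-1 *: D') by rewrite scalerA divff ?gt_eqF ?scale1r.
have -> : E' = y *: (y^-1 *: E') by rewrite scalerA divff ?gt_eqF ?scale1r.
apply: realizable_scale => //; apply: real_d.
- by rewrite (leq_trans (size_scale_leq _ _)).
- by rewrite (leq_trans (size_scale_leq _ _)).
- by move=> i; apply: scale_dist => //; have := DD' i; rewrite lt_min => /andP[].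
- by move=> i; apply: scale_dist => //; have := EE' i; rewrite lt_min => /andP[].
Qed.

Lemma robust0 x : 0 < x -> robust 0 0 1 x%:P 0.
Proof.
move=> x0; exists x => // D' E' sD'; rewrite leqn0 size_poly_eq0 => /eqP -> Dx _.
have D'E := size1_polyC sD'; rewrite D'E; apply: realizable0.
have := Dx 0%N; rewrite coefC /= distrC => /(le_lt_trans (ler_norm _)).
by rewrite ltrBlDr ltrDl.
Qed.

Lemma size_massD h D E (w : R) : (size D <= h.+1)%N -> (size E <= h)%N ->
  (size (D + w *: ('X * E) : {poly R})%R <= h.+1)%N.
Proof.
move=> sD sE; rewrite (leq_trans (size_polyD _ _)) // geq_max sD /=.
rewrite (leq_trans (size_scale_leq _ _)) // (leq_trans (size_polyMleq _ _)) //.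
by rewrite size_polyX.
Qed.

Lemma size_leS p n : (size p <= n.+1)%N -> p`_n = 0 -> (size p <= n)%N.
Proof.
move=> sp pn; apply/leq_sizeP => j; rewrite leq_eqVlt => /predU1P[<-//|nj].
by rewrite nth_default // (leq_trans sp).
Qed.

(** For a nearby pair, the drop of both degrees forces [c] and [k] to be explicit ratios of top
    coefficients. These are continuous because [E_h] is nonzero, so they stay positive. *)
Lemma robust_spring h n g D E c k : 0 < c -> 0 < k -> E`_h != 0 ->
  (size D <= h.+2)%N -> (size E <= h.+1)%N ->
  let D' := D + c *: ('X * E) in let E' := E - k^-1 *: D' in
  (size D' <= h.+1)%N -> (size E' <= h)%N ->
  robust h n g D' E' -> robust h.+1 n.+1 g D E.
Proof.
move=> c0 k0 Eh sD sE D' E' sD' sE' rob; apply: robust_seq => Ds Es sD_ sE_ DD EE.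
have cE : c = - D`_h.+1 / E`_h.
  have := nth_default 0 sD'; rewrite coefD coefZ coefXM /= => /eqP.
  by rewrite addrC addr_eq0 => /eqP <-; rewrite mulfK.
have kE : k = D'`_h / E`_h.
  have := nth_default 0 sE'; rewrite coefB coefZ => /eqP; rewrite subr_eq0.
  move=> /eqP Ehk; have -> : D'`_h = k * E`_h by rewrite Ehk mulVKf ?gt_eqF.
  by rewrite mulfK.
pose cs i := - (Ds i)`_h.+1 / (Es i)`_h.
have cc : cs i @[i --> \oo] --> c.
  by rewrite cE; apply: cvgM; [exact: cvgN|exact: cvgV].
pose Ds' i := Ds i + cs i *: ('X * Es i).
have DD' : pcvg Ds' D' by apply: pcvgD => //; apply: pcvgZ => //; apply: pcvgXM.
pose ks i := (Ds' i)`_h / (Es i)`_h.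
have kk : ks i @[i --> \oo] --> k.
  by rewrite kE; apply: cvgM => //; apply: cvgV.
pose Es' i := Es i - (ks i)^-1 *: Ds' i.
have EE' : pcvg Es' E'.
  by apply: pcvgB => //; apply: pcvgZ => //; apply: cvgV => //; rewrite gt_eqF.
have size_mass (x : R) (p q : {poly R}) : (size p <= h.+2)%N -> (size q <= h.+1)%N ->
    (size (q - x *: p : {poly R})%R <= h.+2)%N.
  move=> sp sq; rewrite (leq_trans (size_polyD _ _)) // geq_max size_polyN.
  by rewrite (leq_trans sq) //= (leq_trans (size_scale_leq _ _)).
have sD'_ i : (size (Ds' i) <= h.+2)%N by apply: size_massD.
have rob_near : \forall i \near \oo, robust h n g (Ds' i) (Es' i).
  apply: (@robust_near h.+2) DD' EE' rob => //.
  - by move=> i; apply: size_mass.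
  - exact: size_massD.
  - by apply: size_mass => //; apply: size_massD.
have Eh_near : \forall i \near \oo, (Es i)`_h != 0.
  exact: (cvgr_neq0 _ (EE h) Eh).
have c_near : \forall i \near \oo, 0 < cs i by exact: (cvgr_gt _ cc).
have k_near : \forall i \near \oo, 0 < ks i by exact: (cvgr_gt _ kk).
have [i [robi [Ehi [ci ki]]]] :=
  filter_ex (filterI rob_near (filterI Eh_near (filterI c_near k_near))).
exists i; apply: (realizable_spring ci ki); apply: robust_realizable robi.
  apply: size_leS => //.
  by rewrite coefD coefZ coefXM /= /cs mulNr mulNr divfK ?addrN.
have kD : (ks i)^-1 * (Ds' i)`_h = (Es i)`_h.
  rewrite /ks invfM invrK mulrAC mulVf ?mul1r //.
  by apply: contraTneq ki; rewrite /ks => ->; rewrite mul0r ltxx.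
apply: size_leS; last by rewrite coefB coefZ kD subrr.
rewrite (leq_trans (size_polyD _ _)) // geq_max sE_ size_polyN.
rewrite (leq_trans (size_scale_leq _ _)) //; apply: size_leS => //.
by rewrite coefD coefZ coefXM /= /cs mulNr mulNr divfK ?addrN.
Qed.


Lemma size_subX (x : R) : size (x%:P - 'X : {poly R}) = 2.
Proof. by rewrite -opprB size_polyN size_XsubC. Qed.

Lemma divp_subX p (x : R) : root p x -> p = (x%:P - 'X) * (p %/ (x%:P - 'X)).
Proof. by move=> px; rewrite mulrC divpK // -opprB dvdpNl dvdp_XsubCl. Qed.

Lemma size_divp_subX h p (x : R) :
  (size p <= h.+1)%N -> (size (p %/ (x%:P - 'X))%R <= h)%N.
Proof.
move=> sp; rewrite size_divp -?size_poly_eq0 size_subX //=.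
by rewrite leq_subLR add1n.
Qed.

Lemma coef_le_sum p j : `|p`_j| <= \sum_(l < size p) `|p`_l|.
Proof.
have [jp|pj] := ltnP j (size p); last first.
  by rewrite nth_default // normr0 sumr_ge0.
by rewrite (bigD1 (Ordinal jp)) //= lerDl sumr_ge0.
Qed.

(** The mass that creates the root [nu] depends continuously on the pair because [E.[nu] != 0]. The
    parameter [rho] is free and can be taken so small that [E] is unchanged in the limit. *)
Lemma robust_tank h n g D E (nu w : R) : 0 < nu -> 0 < w -> E.[nu] != 0 ->
  D.[nu] + w * nu * E.[nu] = 0 -> (size D <= h.+1)%N -> (size E <= h)%N ->
  robust h n g (D + w *: ('X * E)) E ->
  robust h n.+1 ((nu%:P - 'X) * g) D E.
Proof.
move=> nu0 w0 Enu Dnu sD sE rob; apply: robust_seq => Ds Es sDs sEs DD EE.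
have Dsnu : (Ds i).[nu] @[i --> \oo] --> D.[nu].
  by apply: (pcvg_horner sDs) => //; apply: cvg_cst.
have Esnu : (Es i).[nu] @[i --> \oo] --> E.[nu].
  by apply: (pcvg_horner sEs) => //; apply: cvg_cst.
pose ws i := - (Ds i).[nu] / (nu * (Es i).[nu]).
have ww : ws i @[i --> \oo] --> w.
  have -> : w = - D.[nu] / (nu * E.[nu]).
    have -> : D.[nu] = - (w * (nu * E.[nu])) by rewrite mulrA;
      apply/eqP; rewrite -addr_eq0 Dnu.
    by rewrite opprK mulfK // mulf_neq0 // gt_eqF.
  apply: cvgM; first exact: cvgN.
  apply: cvgV; first by rewrite mulf_neq0 // gt_eqF.
  by apply: cvgM => //; apply: cvg_cst.
pose Ds' i := Ds i + ws i *: ('X * Es i).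
have sDs' i : (size (Ds' i) <= h.+1)%N by apply: size_massD.
pose Q i := Ds' i %/ (nu%:P - 'X).
have sQ i : (size (Q i) <= h)%N by apply: size_divp_subX.
(* Normalised so that the coefficients of [rho i *: Q i] are at most [1 / (i + 1)]. *)
pose rho i := i.+1%:R^-1 / (1 + \sum_(l < size (Q i)) `|(Q i)`_l|).
have den0 i : 0 < 1 + \sum_(l < size (Q i)) `|(Q i)`_l|.
  by rewrite ltr_wpDr // sumr_ge0.
have rho0 i : 0 < rho i by rewrite divr_gt0 // invr_gt0 ltr0n.
pose Es' i := Es i - rho i *: Q i.
have sEs' i : (size (Es' i) <= h)%N.
  rewrite (leq_trans (size_polyD _ _)) // geq_max sEs size_polyN.
  by rewrite (leq_trans (size_scale_leq _ _)).
have EE' : pcvg Es' E.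
  rewrite -[E]subr0; apply: pcvgB => //.
  apply: (pcvg_dist cvg_harmonic) => i j.
  rewrite coef0 subr0 coefZ normrM gtr0_norm //= /rho -mulrA ger_pMr ?invr_gt0 ?ltr0n //.
  rewrite mulrC ler_pdivrMr // mul1r (le_trans (coef_le_sum _ _)) //.
  by rewrite lerDr.
have rob_near : \forall i \near \oo, robust h n g (Ds' i) (Es' i).
  apply: (@robust_near h.+1) rob => //.
  - by move=> i; rewrite leqW.
  - exact: size_massD.
  - by rewrite leqW.
  - by apply: pcvgD => //; apply: pcvgZ => //; apply: pcvgXM.
have E_near : \forall i \near \oo, (Es i).[nu] != 0 by exact: (cvgr_neq0 _ Esnu).
have w_near : \forall i \near \oo, 0 < ws i by exact: (cvgr_gt _ ww).
have [i [robi [Ei wi]]] :=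
  filter_ex (filterI rob_near (filterI E_near w_near)).
exists i; apply: (realizable_tank wi (rho0 i) nu0 _ (robust_realizable _ _ robi)) => //.
apply: divp_subX; rewrite /root hornerD hornerZ hornerM hornerX /ws; apply/eqP.
by field; rewrite Ei gt_eqF.
Qed.

(* Removing the mass [w nu] makes [nu] a root of [D]. *)
Lemma robust_tanks h n g D E (w : R -> R) (nus : seq R) (a : R) :
  (size D <= h.+1)%N -> (size E <= h)%N ->
  (forall nu, nu \in nus ->
     [/\ 0 < nu, E.[nu] != 0 & D.[nu] + w nu * nu * E.[nu] = 0]) ->
  path <%R a (map w nus) ->
  robust h n g (D + last a (map w nus) *: ('X * E)) E ->
  robust h (n + size nus) (\prod_(nu <- nus) (nu%:P - 'X) * g)
    (D + a *: ('X * E)) E.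
Proof.
move=> sD sE; elim: nus a => [|nu nus IHnus] a nusP /=.
  by rewrite addn0 big_nil mul1r.
move=> /andP[lt_a path_nus] rob.
have [nu0 Enu Dnu] := nusP nu (mem_head _ _).
(* The mass [a] is already removed, so only [w nu - a] remains, positive because the path
   increases. *)
rewrite addnS big_cons -mulrA; apply: (@robust_tank _ _ _ _ _ nu (w nu - a)) => //.
- by rewrite subr_gt0.
- by rewrite -[RHS]Dnu hornerD hornerZ hornerM hornerX; ring.
- exact: size_massD.
rewrite -addrA -scalerDl [a + _]addrC subrK; apply: IHnus => // nu' nu's.
by apply: nusP; rewrite inE nu's orbT.
Qed.

End Robust.

(** * Chains with prescribed multiplicities *)

Section Spectrum.
Local Open Scope classical_set_scope.
Variable R : realType.
Implicit Types (g D E : {poly R}) (n h : nat).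

(** The inductive step: a new lowest root [lam] is added, and the common factor gains [nu - X] for
    each [nu] in [nus]. The last two conclusions on [E'] supply what the next step needs. *)
Lemma robust_extend h n g D E (lam mu : R) (nus : seq R) :
  0 < lam -> lam < mu -> size D = h.+1 -> (size E <= h)%N ->
  (forall x, 0 < x -> x < mu -> 0 < D.[x] /\ 0 < E.[x]) ->
  (forall nu, nu \in nus -> [/\ mu <= nu, D.[nu] = 0 & E.[nu] != 0]) ->
  sorted >%R nus -> robust h n g D E ->
  exists E', [/\ (size E' <= h.+1)%N,
    robust h.+1 (n + size nus).+1 (\prod_(nu <- nus) (nu%:P - 'X) * g)
      ((lam%:P - 'X) * D) E',
    forall nu, mu <= nu -> D.[nu] = 0 -> E.[nu] != 0 -> E'.[nu] != 0
    & forall x, 0 < x -> x <= lam -> 0 < E'.[x]].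
Proof.
move=> lam0 lam_mu sD sE pos nusP sorted_nus rob.
pose kap i : R := lam + (mu - lam) / 2 * i.+1%:R^-1.
have kapP i : lam < kap i < mu.
  have i0 : 0 < i.+1%:R^-1 :> R by rewrite invr_gt0 ltr0n.
  have i1 : i.+1%:R^-1 <= 1 :> R by rewrite invf_le1 ?ler1n ?ltr0n.
  have d0 : 0 < (mu - lam) / 2 by rewrite divr_gt0 ?subr_gt0.
  rewrite ltrDl mulr_gt0 //= -ltrBrDl (le_lt_trans (ler_piMr (ltW d0) i1)) //.
  by rewrite ltr_pdivrMr // ltr_pMr ?subr_gt0 // ltr1n.
have kap_cvg : kap i @[i --> \oo] --> lam.
  rewrite -[X in _ --> X]addr0 -[X in _ --> _ + X](mulr0 ((mu - lam) / 2)).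
  by apply: cvgD; [exact: cvg_cst|apply: cvgM; [exact: cvg_cst|exact: cvg_harmonic]].
have kap0 i : 0 < kap i by case/andP: (kapP i) => /(lt_trans lam0).
have Dk i : 0 < D.[kap i] by case/andP: (kapP i) => _ /(pos _ (kap0 i))[].
have Ek i : 0 < E.[kap i] by case/andP: (kapP i) => _ /(pos _ (kap0 i))[].
(* Chosen so that adding [eta i X E] moves the root [lam] of [(lam - X) D] to [kap i]; it is
   positive and tends to 0. *)
pose eta i := (kap i - lam) * D.[kap i] / (kap i * E.[kap i]).
have eta0 i : 0 < eta i.
  by rewrite !(mulr_gt0, invr_gt0) // subr_gt0; case/andP: (kapP i).
have eta_cvg : eta i @[i --> \oo] --> 0.
  rewrite -[X in _ --> X](_ : (lam - lam) * D.[lam] / (lam * E.[lam]) = 0).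
    apply: cvgM; first apply: cvgM.
    - by apply: cvgB => //; apply: cvg_cst.
    - by apply: (@pcvg_horner _ h.+1) => //; [rewrite sD|rewrite sD|exact: pcvg_cst].
    - apply: cvgV; first by rewrite gt_eqF // mulr_gt0 //; case: (pos lam).
      apply: cvgM => //; apply: (@pcvg_horner _ h) => //; exact: pcvg_cst.
  by rewrite subrr !mul0r.
pose N i := (lam%:P - 'X) * D + eta i *: ('X * E).
have rootN i : root (N i) (kap i).
  rewrite /root /N hornerD hornerZ !hornerM hornerD hornerN hornerC hornerX /eta.
  by apply/eqP; field; rewrite !gt_eqF.
have sN i : (size (N i) <= h.+2)%N.
  apply: size_massD; last by rewrite leqW.
  by rewrite (leq_trans (size_polyMleq _ _)) // size_subX sD.
pose D1 i := N i %/ ((kap i)%:P - 'X).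
have sD1 i : (size (D1 i) <= h.+1)%N by apply: size_divp_subX.
have ND1 i : N i = ((kap i)%:P - 'X) * D1 i by apply: divp_subX.
have D1_cvg : pcvg D1 D.
  apply: (@pcvg_divXsub _ h.+1 N ((lam%:P - 'X) * D) D1 D kap lam) => //.
    by rewrite sD.
  rewrite -[X in pcvg _ X]addr0 -[X in pcvg _ (_ + X)](scale0r ('X * E)).
  by apply: pcvgD; [exact: pcvg_cst|apply: pcvgZ => //; exact: pcvg_cst].
(* At a root [nu] of [D], [(kap i - nu) D1(nu) = eta i nu E(nu)], so removing this mass from
   [(D1 i, E)] creates the root [nu]. It grows as [nu] decreases, hence the decreasing order of
   [nus]. *)
pose w i nu := eta i / (nu - kap i).
have last_cvg : last 0 (map (w i) nus) @[i --> \oo] --> 0.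
  case/lastP: nus {nusP sorted_nus} (nusP : forall nu, _) => [|nus nu] nusP /=.
    exact: cvg_cst.
  rewrite (_ : (fun i => _) = w ^~ nu); last first.
    by apply/funext => i; rewrite map_rcons last_rcons.
  rewrite -(mul0r (nu - lam)^-1); apply: cvgM => //; apply: cvgV.
    rewrite subr_eq0 gt_eqF // (lt_le_trans lam_mu) //.
    by case: (nusP nu); rewrite // mem_rcons mem_head.
  by apply: cvgB => //; apply: cvg_cst.
have rob_near : \forall i \near \oo,
    robust h n g (D1 i + last 0 (map (w i) nus) *: ('X * E)) E.
  apply: (@robust_near _ h.+1 _ _ _ D E _ (fun=> E)) => //.
  - by move=> i; apply: size_massD.
  - by rewrite leqW.
  - by rewrite sD.
  - by rewrite leqW.
  - rewrite -[X in pcvg _ X]addr0 -[X in pcvg _ (_ + X)](scale0r ('X * E)).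
    by apply: pcvgD => //; apply: pcvgZ => //; exact: pcvg_cst.
  - exact: pcvg_cst.
have [i robi] := filter_ex rob_near.
case/andP: (kapP i) => lam_k k_mu.
have D1h x : (kap i - x) * (D1 i).[x] = (lam - x) * D.[x] + eta i * x * E.[x].
  have := congr1 (fun p : {poly R} => p.[x]) (ND1 i); rewrite /N hornerD hornerZ !hornerM.
  by rewrite !hornerD !hornerN !hornerC !hornerX mulrA => <-.
have D1nu nu : mu <= nu -> D.[nu] = 0 -> (D1 i).[nu] = - (w i nu * nu * E.[nu]).
  move=> mu_nu Dnu; have k_nu : kap i - nu != 0.
    by rewrite subr_eq0 lt_eqF // (lt_le_trans k_mu).
  apply: (mulfI k_nu); rewrite D1h Dnu /w; field.
  by rewrite -opprB oppr_eq0.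
have := @robust_tanks _ h n g (D1 i) E (w i) nus 0 (sD1 i) sE.
rewrite scale0r addr0 => /(_ _ _ robi) rob1.
have {}rob1 : robust h (n + size nus) (\prod_(nu <- nus) (nu%:P - 'X) * g) (D1 i) E.
  apply: rob1 => [nu /nusP[mu_nu Dnu Enu]|].
    split=> //; last by rewrite D1nu // addNr.
    by rewrite (lt_le_trans _ mu_nu) // (lt_trans lam0).
  rewrite path_sortedE; last exact: lt_trans.
  apply/andP; split.
    apply/allP => _ /mapP[nu /nusP[mu_nu _ _] ->].
    by rewrite divr_gt0 // subr_gt0 (lt_le_trans k_mu).
  apply: (@homo_sorted_in _ _ (fun nu => kap i < nu) _ >%R) sorted_nus.
    move=> x y kx ky yx; rewrite -[_ \in _]/(kap i < x) in kx.
    rewrite -[_ \in _]/(kap i < y) in ky; rewrite /= in yx.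
    by rewrite /w ltr_pM2l // ltf_pV2 ?posrE ?subr_gt0 // ltrD2r.
  by apply/allP => nu /nusP[mu_nu _ _]; apply: lt_le_trans mu_nu.
(* Removing a unit mass then leaves [kap i D1], and removing a spring of stiffness [kap i] leaves
   [eta i E]: up to scaling, the pair [(D1 i, E)]. *)
pose E' := eta i *: E + D1 i.
have DE' : (lam%:P - 'X) * D + 1 *: ('X * E') = kap i *: D1 i.
  have -> : (lam%:P - 'X) * D = ((kap i)%:P - 'X) * D1 i - eta i *: ('X * E).
    by rewrite -ND1 addrK.
  by rewrite /E' -!mul_polyC polyC1; ring.
have E'E : E' - (kap i)^-1 *: (kap i *: D1 i) = eta i *: E.
  by rewrite scalerA mulVf ?gt_eqF // scale1r addrK.
exists E'; split.
- rewrite (leq_trans (size_polyD _ _)) // geq_max sD1.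
  by rewrite (leq_trans (size_scale_leq _ _)) // leqW.
- apply: (robust_spring (c := 1) (k := kap i)) => //.
  (* The coefficient of [E'] in degree [h] is that of [D1 i], equal to the leading coefficient of
     [D]. *)
  + rewrite coefD coefZ (nth_default 0 sE) mulr0 add0r.
    have := congr1 (fun p : {poly R} => p`_h.+1) (ND1 i).
    rewrite /N coefD coefZ coefXM /= (nth_default 0 sE) mulr0 addr0.
    rewrite !mulrBl !coefB !coefCM !coefXM /=.
    rewrite [D`_h.+1]nth_default ?sD // [(D1 i)`_h.+1]nth_default //.
    rewrite !mulr0 !sub0r => /oppr_inj <-.
    by rewrite -[h]/(h.+1.-1) -sD lead_coef_eq0 -size_poly_eq0 sD.
  + by rewrite (leq_trans (size_polyMleq _ _)) // size_subX sD.
  + rewrite (leq_trans (size_polyD _ _)) // geq_max sD1.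
    by rewrite (leq_trans (size_scale_leq _ _)) // leqW.
  + by rewrite DE' (leq_trans (size_scale_leq _ _)).
  + by rewrite DE' E'E (leq_trans (size_scale_leq _ _)).
  + by rewrite DE' E'E; apply: robust_scale.
- move=> nu mu_nu Dnu Enu; rewrite /E' hornerD hornerZ D1nu //.
  have k_nu : 0 < nu - kap i by rewrite subr_gt0 (lt_le_trans k_mu).
  have -> : eta i * E.[nu] - w i nu * nu * E.[nu] =
      - (eta i * kap i / (nu - kap i)) * E.[nu].
    by rewrite /w; field; rewrite gt_eqF.
  by rewrite mulNr oppr_eq0 mulf_neq0 // gt_eqF // divr_gt0 // mulr_gt0.
move=> x x0 x_lam; have x_k : 0 < kap i - x by rewrite subr_gt0 (le_lt_trans x_lam).
have [Dx Ex] := pos x x0 (le_lt_trans x_lam lam_mu).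
rewrite /E' hornerD hornerZ ltr_wpDl //.
  exact: ltW (mulr_gt0 (eta0 i) Ex).
rewrite -(pmulr_rgt0 _ x_k) D1h ltr_wpDl //.
  by rewrite mulr_ge0 ?subr_ge0 // ltW.
exact: mulr_gt0 (mulr_gt0 (eta0 i) x0) Ex.
Qed.


(** A pair [(x, u)] stands for an eigenvalue [x] of multiplicity [u + 1]: one factor in [D] and [u]
    hidden in the common factor. *)
Definition spectrum (s : seq (R * nat)) : {poly R} := \prod_(p <- s) (p.1%:P - 'X).

Definition hidden (s : seq (R * nat)) : {poly R} :=
  \prod_(p <- s) (p.1%:P - 'X) ^+ p.2.

Lemma size_spectrum s : size (spectrum s) = (size s).+1.
Proof.
elim: s => [|p s IHs]; first by rewrite /spectrum big_nil size_poly1.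
rewrite /spectrum big_cons -/(spectrum s).
by rewrite size_mul -?size_poly_eq0 ?size_subX ?IHs.
Qed.

Lemma horner_spectrum s x : (spectrum s).[x] = \prod_(p <- s) (p.1 - x).
Proof.
rewrite horner_prod; apply: eq_bigr => p _.
by rewrite hornerD hornerN hornerC hornerX.
Qed.

(** Induction on the number of eigenvalues: the bound forces the first one to be simple, and
    [robust_extend] adds it while raising the positive hidden exponents of the others by one. *)
Lemma robust_spectrum (s : seq (R * nat)) : s != [::] ->
  sorted <%R (map fst s) -> {in s, forall p, 0 < p.1} ->
  (forall i, (i < size s)%N -> ((nth (0%R, 0) s i).2 <= i)%N) ->
  exists E, [/\ (size E <= size s)%N,
    robust (size s) (size s + \sum_(p <- s) p.2) (hidden s) (spectrum s) E,
    {in s, forall p, E.[p.1] != 0}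
    & forall x, 0 < x -> {in s, forall p, x < p.1} -> 0 < E.[x]].
Proof.
move: {2}(size s) (erefl (size s)) => m; elim: m s => [|m IHm] [//|[lam u] s] //=.
move=> [sizes] _ path_s pos_s le_s.
have lam0 : 0 < lam by apply: (pos_s (lam, u)); rewrite mem_head.
have u0 : u = 0%N by apply/eqP; rewrite -leqn0; apply: (le_s 0%N).
case: s => [|[mu v] s] in sizes path_s pos_s le_s *.
  (* A single oscillator with unit mass and stiffness [lam]. *)
  exists 1; split; rewrite ?size_poly1 //.
  - rewrite /hidden /spectrum !big_seq1 u0 expr0 /=.
    have DE : lam%:P - 'X + 1 *: ('X * 1) = lam%:P :> {poly R}.
      by rewrite scale1r mulr1 subrK.
    apply: (robust_spring (c := 1) (k := lam)) => //.
    + by rewrite coef1 oner_eq0.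
    + by rewrite size_subX.
    + by rewrite size_poly1.
    + by rewrite DE size_polyC leq_b1.
    + by rewrite DE -mul_polyC -polyCM mulVf ?gt_eqF // subrr size_poly0.
    by rewrite DE -mul_polyC -polyCM mulVf ?gt_eqF // subrr; apply: robust0.
  - by move=> p _; rewrite hornerC oner_eq0.
  - by move=> x _ _; rewrite hornerC.
set s' := (mu, v) :: s in sizes path_s pos_s le_s *.
have lam_s' : {in s', forall p, lam < p.1}.
  move=> p ps'; have := path_s; rewrite path_sortedE; last exact: lt_trans.
  by case/andP => /allP + _; apply; apply: map_f.
have mu_s' : {in s', forall p, mu <= p.1}.
  move=> p; rewrite inE => /predU1P[-> //|ps]; apply: ltW.
  move: path_s => /= /andP[_]; rewrite path_sortedE; last exact: lt_trans.
  by case/andP => /allP + _; apply; apply: map_f.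
have lam_mu : lam < mu by apply: (lam_s' (mu, v)); rewrite mem_head.
have s'_neq0 : s' != [::] by [].
(* Truncation at 0 keeps simple eigenvalues simple, and dropping the first index turns the bound
   [i.+1] on exponents into [i]. *)
clearbody s'; pose t := [seq (p.1, p.2.-1) | p <- s'].
have [|||||E [sE rob Et Epos]] := IHm t.
- by rewrite size_map.
- by rewrite -size_eq0 size_map size_eq0.
- by rewrite -map_comp; apply: path_sorted path_s.
- by move=> _ /mapP[p ps' ->]; exact: (lt_trans lam0 (lam_s' p ps')).
- move=> i; rewrite size_map => lt_i; rewrite (nth_map (0, 0%N)) //=.
  by rewrite -subn1 leq_subLR add1n; apply: (le_s i.+1).
rewrite size_map in sE rob.
have spec_t : spectrum t = spectrum s' by rewrite /spectrum big_map.
pose nus := rev [seq p.1 | p <- s' & (0 < p.2)%N].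
have nusE nu : nu \in nus -> exists2 p, p \in s' & nu = p.1.
  rewrite mem_rev => /mapP[p]; rewrite mem_filter => /andP[_ ps'] ->.
  by exists p.
have root_s' : {in s', forall p, (spectrum s').[p.1] = 0}.
  move=> p ps'; rewrite horner_spectrum; apply/eqP; rewrite prodf_seq_eq0.
  by apply/hasP; exists p => //=; rewrite subrr.
have E_s' : {in s', forall p, E.[p.1] != 0}.
  by move=> p ps'; apply: (Et (p.1, p.2.-1)); apply: (map_f (fun p => (p.1, p.2.-1))).
have [||||||||E' [sE' rob' Enu' Epos']] :=
  @robust_extend (size s') (size s' + \sum_(p <- t) p.2) (hidden t)
    (spectrum s') E lam mu nus.
- by [].
- by [].
- exact: size_spectrum.
- by [].
- move=> x x0 x_mu; split.
    rewrite horner_spectrum big_seq; apply: prodr_gt0 => p ps'.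
    by rewrite subr_gt0 (lt_le_trans x_mu) ?mu_s'.
  apply: Epos => // _ /mapP[p ps' ->].
  exact: lt_le_trans x_mu (mu_s' p ps').
- by move=> nu /nusE[p ps' ->]; rewrite mu_s' ?root_s' ?E_s'.
- rewrite rev_sorted sorted_map; apply: sorted_filter.
    by move=> ? ? ?; apply: lt_trans.
  by rewrite -sorted_map; apply: path_sorted path_s.
- by rewrite -spec_t.
exists E'; split.
- by [].
- move: rob'; rewrite /spectrum /hidden !big_cons u0 expr0 mul1r add0n addSn.
  have -> : (size s' + \sum_(p <- t) p.2 + size nus =
      size s' + \sum_(p <- s') p.2)%N.
    rewrite -addnA; congr (_ + _)%N; rewrite size_rev size_map size_filter big_map.
    rewrite -sum1_count [X in (_ + X)%N]big_mkcond -big_split /=.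
    by apply: eq_bigr => -[x [|w]] _ //=; rewrite addn1.
  suff -> : \prod_(nu <- nus) (nu%:P - 'X) * \prod_(p <- t) (p.1%:P - 'X) ^+ p.2 =
      \prod_(p <- s') (p.1%:P - 'X) ^+ p.2 by [].
  rewrite (perm_big _ (permEl (perm_rev _))) !big_map big_filter /=.
  rewrite big_mkcond -big_split; apply: eq_bigr => -[x [|w]] _ /=.
    by rewrite mul1r.
  by rewrite exprS.
- move=> p; rewrite inE => /predU1P[->|ps'] /=.
    by rewrite gt_eqF // Epos'.
  by rewrite Enu' ?mu_s' ?root_s' ?E_s'.
- move=> x x0 x_s; apply: Epos' => //; apply: ltW.
  by apply: (x_s (lam, u)); rewrite mem_head.
Qed.

End Spectrum.

Theorem theorem2p1 (R : realType) (n m : nat)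
  (lam : 'I_m -> R) (t : 'I_m -> nat)
  (m_ge1 : (1 <= m)%N) (n_gem : (m <= n)%N)
  (lam_gt0 : forall i : 'I_m, 0 < lam i)
  (lam_incr : forall i j : 'I_m, (i < j)%N -> lam i < lam j)
  (t_gt0 : forall i : 'I_m, (0 < t i)%N)
  (sum_t : (\sum_(i < m) t i)%N = n) :
  (exists mass k b : 'I_n -> R,
     [/\ forall j : 'I_n, 0 < mass j,
         forall j : 'I_n, 0 < k j,
         forall j : 'I_n, 0 <= b j
       & \prod_(i < m) ('X - (lam i)%:P) ^+ t i
           %| pencil_det (chain_mx k) (mass_mx mass + chain_mx b)])
  <-> (forall i : 'I_m, (t i <= i.+1)%N).
Proof.
split=> [[mass [k [b [mass0 k0 b0 dvd_prod]]]] i|t_le].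
  apply: (multiplicity_le mass0 k0 b0 lam_gt0 lam_incr _ i sum_t t_gt0) => // l.
  by apply: dvdp_trans dvd_prod; rewrite (bigD1 l) //= dvdp_mulr.
(* The [m] visible roots and the hidden exponents [t i - 1] together account for [n] masses. *)
pose s := [seq (lam i, (t i).-1) | i <- enum 'I_m].
have sizes : size s = m by rewrite size_map size_enum_ord.
have [||||E [sE rob _ _]] := @robust_spectrum _ s.
- by rewrite -size_eq0 sizes -lt0n.
- rewrite -map_comp sorted_map.
  have : sorted (relpre val ltn) (enum 'I_m).
    by rewrite -sorted_map val_enum_ord iota_ltn_sorted.
  by apply: sub_sorted => i j; apply: lam_incr.
- by move=> _ /mapP[i _ ->]; apply: lam_gt0.
- rewrite sizes => i im; rewrite (nth_map (Ordinal im)) ?size_enum_ord //=.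
  rewrite -[X in nth _ _ X]/(val (Ordinal im)) nth_ord_enum.
  by rewrite -ltnS prednK.
have nE : (size s + \sum_(p <- s) p.2)%N = n.
  rewrite sizes big_map big_enum /= -[RHS]sum_t.
  rewrite [RHS](eq_bigr (fun i => 1 + (t i).-1)%N) => [|i _].
    by rewrite big_split /= sum1_card card_ord.
  by rewrite add1n prednK.
rewrite nE in rob.
have [||mass [k [b [mass0 k0 b0 [a [c [_ _ chainE]]]]]]] := robust_realizable _ _ rob.
- by rewrite size_spectrum.
- by [].
exists mass, k, b; split=> //; rewrite pencil_det_chain chainE /=.
rewrite /hidden /spectrum -big_split big_map big_enum /= -mul_polyC dvdp_mull //.
(* The factors [lam i - X] of the construction differ from [X - lam i] only by signs. *)
have -> : \prod_(i < m) (((lam i)%:P - 'X) ^+ (t i).-1 * ((lam i)%:P - 'X)) =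
    (\prod_(i < m) (-1) ^+ t i) * \prod_(i < m) ('X - (lam i)%:P) ^+ t i
    :> {poly R}.
  rewrite -big_split; apply: eq_bigr => i _ /=.
  by rewrite -exprSr prednK // -exprMn mulN1r opprB.
exact: dvdp_mulIr.
Qed.
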